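(* Let $d\ge 2$ and $b\in C^0_\sharp(Y_d)^d$. Then the following assertions are equivalent: (i) There exist a positive function $\sigma\in C^0_\sharp(Y_d)$ and a vector field $V=(v_1,\dots,v_d)\in C^1(\mathbb{R}^d)^d$ with $DV\in C^0_\sharp(Y_d)^{d\times d}$ such that $$b\cdot\nabla v_1=1\quad\text{in }Y_d,$$ $$\sigma b=\begin{cases}R_\perp\nabla v_2 & \text{if }d=2,\\ \nabla v_2\times\cdots\times\nabla v_d & \text{if }d\ge 3,\end{cases}\quad\text{in }Y_d.$$ (ii) There exist a vector field $W\in C^1(\mathbb{R}^d)^d$ and a non-zero vector $\xi\in\mathbb{R}^d$ such that $$DW\in C^0_\sharp(Y_d)^{d\times d}\ \text{ with }\ \langle DW\rangle=I_d,\qquad \det(DW)\ne 0\ \text{ in }Y_d,\qquad (DW)^Tb=\xi\ \text{ in }Y_d.$$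
   Context: $Y_d:=[0,1)^d$; a function $f$ on $\mathbb{R}^d$ is $Y_d$-periodic if $f(x+\kappa)=f(x)$ for all $\kappa\in\mathbb{Z}^d$; $C^k_\sharp(Y_d)$ is the space of $Y_d$-periodic functions of class $C^k$ in $\mathbb{R}^d$; $\langle f\rangle$ is the average value of $f$ over $Y_d$. For $U=(U_1,\dots,U_d)$, $DU:=[\partial_{x_i}U_j]_{1\le i,j\le d}$ (so the $j$-th column of $DU$ is $\nabla U_j$). $M^T$ is the transpose of $M$ and $I_d$ is the unit matrix. $R_\perp$ is the clockwise $90^\circ$ rotation matrix in $\mathbb{R}^{2\times2}$. For $\xi^2,\dots,\xi^d\in\mathbb{R}^d$, the cross product $\xi^2\times\cdots\times\xi^d\in\mathbb{R}^d$ is defined by $\xi^1\cdot(\xi^2\times\cdots\times\xi^d)=\det(\xi^1,\xi^2,\dots,\xi^d)$ for all $\xi^1\in\mathbb{R}^d$. *)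

(* Defs.v *)
From HB Require Import structures.
From mathcomp Require Import all_boot all_order all_algebra.
From mathcomp Require Import all_classical all_reals all_analysis.
Import Order.TTheory GRing.Theory Num.Theory.
Import numFieldNormedType.Exports.

Set Implicit Arguments.
Unset Strict Implicit.
Unset Printing Implicit Defensive.

Local Open Scope classical_set_scope.
Local Open Scope ring_scope.

(* Points of R^d and values of vector fields are row vectors. *)

Section Vectors.
Context {R : realType}.

Definition dot d (u v : 'rV[R]_d) : R := \sum_i u 0 i * v 0 i.

(* The square matrix with columns x, xi 0, ..., xi (n - 1). *)
Definition cols_mx n (x : 'rV[R]_n.+1) (xi : 'I_n -> 'rV[R]_n.+1) :
    'M[R]_n.+1 :=
  \matrix_(i, j) (if unlift ord0 j is Some k then xi k else x) 0 i.

Definition cross_product n (xi : 'I_n -> 'rV[R]_n.+1) : 'rV[R]_n.+1 :=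
  \row_i \det (cols_mx (delta_mx 0 i) xi).

Lemma dot_cross_product n (xi : 'I_n -> 'rV[R]_n.+1) (x : 'rV[R]_n.+1) :
  dot x (cross_product xi) = \det (cols_mx x xi).
Proof.
have cofE (y : 'rV[R]_n.+1) i :
    cofactor (cols_mx y xi) i ord0 = cofactor (cols_mx x xi) i ord0.
  rewrite /cofactor; congr (_ * \det _).
  by apply/matrixP => k l; rewrite !mxE liftK.
have detE (y : 'rV[R]_n.+1) :
    \det (cols_mx y xi) = \sum_i y 0 i * cofactor (cols_mx x xi) i ord0.
  rewrite (expand_det_col _ ord0); apply: eq_bigr => i _.
  by rewrite cofE mxE unlift_none.
rewrite detE; apply: eq_bigr => i _; rewrite mxE detE; congr (_ * _).
rewrite (bigD1 i)//= big1 ?addr0 => [|j ji]; first by rewrite mxE !eqxx mul1r.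
by rewrite mxE eqxx (negPf ji) mul0r.
Qed.

(* Clockwise rotation by a right angle, acting on column vectors. *)
Definition R_perp : 'M[R]_2 := (block_mx 0 1%:M (-1)%:M 0 : 'M[R]_(1 + 1)).

(* For vectors g 0, ..., g (d - 1) of R^d with d >= 2: R_perp (g 1) if d = 2
   and g 1 x ... x g (d - 1) if d >= 3. *)
Definition perp_product n : ('I_n.+2 -> 'rV[R]_n.+2) -> 'rV[R]_n.+2 :=
  match n with
  | 0 => fun g => (R_perp *m (g 1)^T)^T
  | _.+1 => fun g => cross_product (fun j => g (lift ord0 j))
  end.

End Vectors.

Section Calculus.
Context {R : realType}.

Definition gradient d (f : 'rV[R]_d -> R) (x : 'rV[R]_d) : 'rV[R]_d :=
  \row_i 'D_(delta_mx 0 i) f x.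

Definition comp_field d m (U : 'rV[R]_d -> 'rV[R]_m) (j : 'I_m) :
  'rV[R]_d -> R := fun x => U x 0 j.

(* DU is the library Jacobian 'J U: as it acts on row vectors from the right,
   its (i, j) entry is the i-th partial derivative of the j-th component. *)
Lemma jacobianE d m (U : 'rV[R]_d -> 'rV[R]_m) (x : 'rV[R]_d) i j :
  differentiable U x -> ('J U x) i j = gradient (comp_field U j) x 0 i.
Proof.
move=> dU.
have dU' : derivable U x (delta_mx 0 i) by exact: diff_derivable.
rewrite mxE /gradient mxE -deriveE// derive_mx// mxE; congr ('D__ _ _).
Qed.

Definition class_C1 d m (U : 'rV[R]_d -> 'rV[R]_m) : Prop :=
  (forall x, differentiable U x) /\ continuous (fun x => 'J U x).

Definition Yd_periodic d (T : Type) (f : 'rV[R]_d -> T) : Prop :=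
  forall (x : 'rV[R]_d) (k : 'rV[int]_d), f (x + map_mx intr k) = f x.

Definition C0_sharp d (T : topologicalType) (f : 'rV[R]_d -> T) : Prop :=
  continuous f /\ Yd_periodic f.

Definition Yd d : set 'rV[R]_d := [set x | forall i, 0 <= x 0 i < 1].

End Calculus.

(* The library has a measurable structure on tuples, but no measure on them:
   tuple_measure mu n is the n-fold product of mu. *)
Section TupleMeasure.
Context {d : measure_display} {T : measurableType d} {R : realType}.
Variable mu : {sigma_finite_measure set T -> \bar R}.

Definition tcons n (p : T * n.-tuple T) : n.+1.-tuple T :=
  [the n.+1.-tuple T of p.1 :: p.2].

Definition tuncons n (t : n.+1.-tuple T) : T * n.-tuple T :=
  (tnth t ord0, [tuple of behead t]).

Lemma measurable_tcons n : measurable_fun setT (@tcons n).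
Proof. exact: measurable_cons. Qed.

Lemma measurable_tuncons n : measurable_fun setT (@tuncons n).
Proof.
apply: measurable_fun_pair; first exact: measurable_tnth.
exact: measurable_behead.
Qed.

Lemma tconsK n : cancel (@tcons n) (@tuncons n).
Proof. by case=> x t; congr pair; exact: val_inj. Qed.

Section Step.
Variables (n : nat) (nu : {sigma_finite_measure set (n.-tuple T) -> \bar R}).

Definition tuple_measure_step : set (n.+1.-tuple T) -> \bar R :=
  pushforward (mu \x nu)%E (@tcons n).

Let step_measure : {measure set (n.+1.-tuple T) -> \bar R} :=
  measure_function_pushforward__canonical__measure_function_Measure
    (mu \x nu)%E (@measurable_tcons n).

Let step0 : tuple_measure_step set0 = 0%E.
Proof. exact: (measure0 step_measure). Qed.

Let step_ge0 A : (0 <= tuple_measure_step A)%E.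
Proof. exact: (measure_ge0 step_measure). Qed.

Let step_sigma_additive : semi_sigma_additive tuple_measure_step.
Proof. exact: (@measure_semi_sigma_additive _ _ _ step_measure). Qed.

HB.instance Definition _ := isMeasure.Build _ _ _
  tuple_measure_step step0 step_ge0 step_sigma_additive.

Let step_sigma_finite : sigma_finite setT tuple_measure_step.
Proof.
have /sigma_finiteP[F [TF ndF Ffin]] := sigma_finiteT mu.
have /sigma_finiteP[G [TG ndG Gfin]] := sigma_finiteT nu.
exists (fun k => @tuncons n @^-1` (F k `*` G k)).
  rewrite -preimage_bigcup -(preimage_setT (@tuncons n)); congr preimage.
  rewrite -setXTT TF TG predeqE => -[x y]; split; last first.
    by move=> [k _ []/= ? ?]; split; exists k.
  move=> [/= [k _ Fkx] [l _ Gly]]; exists (maxn k l) => //; split.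
    by move: x Fkx; exact/subsetPset/ndF/leq_maxl.
  by move: y Gly; exact/subsetPset/ndG/leq_maxr.
move=> k; have [mF Fk] := Ffin k; have [mG Gk] := Gfin k; split.
  by rewrite -[X in measurable X]setTI; apply: measurable_tuncons => //;
    exact: measurableX.
rewrite /tuple_measure_step /pushforward -comp_preimage.
rewrite (_ : _ \o _ = id) ?preimage_id; last exact/funext/tconsK.
by rewrite product_measure1E// lte_mul_pinfty// ge0_fin_numE.
Qed.

HB.instance Definition _ := Measure_isSigmaFinite.Build _ _ _
  tuple_measure_step step_sigma_finite.

End Step.

Fixpoint tuple_measure n : {sigma_finite_measure set (n.-tuple T) -> \bar R} :=
  match n with
  | 0 => \d_([tuple] : 0.-tuple T)
  | m.+1 => tuple_measure_step (tuple_measure m)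
  end.

Lemma tuple_measure_box n (A : 'I_n -> set T) :
  (forall i, measurable (A i)) ->
  tuple_measure n [set t | forall i, A i (tnth t i)] = (\prod_i mu (A i))%E.
Proof.
elim: n A => [|n IHn] A mA.
  rewrite big_ord0 /= diracE mem_set//=; by case.
pose B : set (n.-tuple T) := [set t | forall i, A (lift ord0 i) (tnth t i)].
have mB : measurable B.
  have -> : B = \bigcap_i ((@tnth n T)^~ i @^-1` A (lift ord0 i)).
    by apply/seteqP; split => t Bt i; [move=> _|]; exact: Bt.
  apply: fin_bigcap_measurable => // i _; rewrite -[X in measurable X]setTI.
  exact: measurable_tnth.
rewrite big_ord_recl -IHn// -product_measure1E//=.
rewrite /tuple_measure_step /pushforward; congr product_measure1.
apply/seteqP; split => -[x t] /=.
  move=> H; split; first exact: (H ord0).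
  by move=> i; have := H (lift ord0 i); rewrite tnthS.
case=> /= Ax Bt i; case: (unliftP ord0 i) => [j|] ->//.
by rewrite tnthS; exact: Bt.
Qed.

End TupleMeasure.

Section Average.
Context {R : realType}.

Definition row_of_tuple d (t : d.-tuple R) : 'rV[R]_d := \row_i tnth t i.

Lemma Yd_measure1 n :
  tuple_measure (@lebesgue_measure R) n (@row_of_tuple n @^-1` @Yd R n) = 1%E.
Proof.
pose I : set (measurableTypeR R) := `[0, 1[%classic.
rewrite (_ : _ @^-1` _ = [set t | forall i, (fun=> I) i (tnth t i)]).
  rewrite (@tuple_measure_box _ _ _ _ _ (fun=> I)) => [|i]; last first.
    exact: measurable_itv.
  rewrite big1// => i _; have := lebesgue_measure_itv `[(0 : R), 1[.
  by rewrite /= lte_fin ltr01 -EFinB subr0.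
by apply/seteqP; split => t /= H i; have := H i; rewrite mxE /I /= in_itv.
Qed.

(* No normalization is needed, by Yd_measure1. *)
Definition average d (f : 'rV[R]_d -> R) : R :=
  \int[tuple_measure (@lebesgue_measure R) d]_(
      t in @row_of_tuple d @^-1` @Yd R d) f (row_of_tuple t).

Definition average_mx d m n (M : 'rV[R]_d -> 'M[R]_(m, n)) : 'M[R]_(m, n) :=
  \matrix_(i, j) average (fun x => M x i j).

End Average.

(* Main.v *)
Require Import Defs.
From mathcomp Require Import all_boot all_order all_algebra.
From mathcomp Require Import all_classical all_reals all_analysis.
From mathcomp Require Import perm measurable_realfun ring lra.
Import Order.TTheory GRing.Theory Num.Theory.
Import numFieldNormedType.Exports.
Local Open Scope classical_set_scope.
Local Open Scope ring_scope.
Set Implicit Arguments.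
Unset Strict Implicit.
Unset Printing Implicit Defensive.

(** Write DV for 'J V. The two equations of (i) say the same as
    b *m DV = (1, 0, ..., 0) together with sigma = det DV > 0: by the
    definition of the cross product, the product of the gradients of
    v_2, ..., v_d is a vector c with c *m DV = det DV *: (1, 0, ..., 0)
    ([perp_product_gradient]). So both (i) and (ii) ask for coordinates with
    periodic invertible Jacobian in which b is constant, and one passes from
    one to the other by a constant invertible matrix A, with V = W *m A.

    From (ii) to (i), A must send xi to the first basis vector and make
    det DV positive. The sign of det DW is constant, because det DW is
    continuous and does not vanish, and the sign of det A is free as d >= 2
    ([straightening_matrix]).

    From (i) to (ii), A must be the inverse of the average of DV, and the point
    is that this average is invertible ([average_jacobian_unit]). One could
    use that the determinant is a null Lagrangian, so that the determinant of
    the average is the average of det DV; for maps that are only C^1 the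
    following is more elementary. The i-th row of the average of DV is the
    increment V (x + e_i) - V x, which does not depend on x since DV is periodic
    ([increment_cst], [average_jacobian_row]). If the average kills a column
    c <> 0, then V *m c is periodic, so it has a maximum, and there
    DV *m c = 0, against det DV <> 0.

    To identify increments with averages, integrate along the i-th axis by the
    fundamental theorem of calculus, and then over the other axes by Tonelli's
    theorem, through the recursion that defines the product measure on tuples
    ([integral_tuple_coord], [average_line]). *)

(** * Measurability of continuous functions of a tuple *)

Lemma measurable_ball_row_of_tuple (R : realType) d (c : 'rV[R]_d) (e : R) :
  0 < e -> measurable (@row_of_tuple R d @^-1` ball c e).
Proof.
move=> e0.
rewrite (_ : _ @^-1` _ =
    \bigcap_i ((@tnth d (measurableTypeR R))^~ i @^-1` ball (c 0 i) e)).
  apply: fin_bigcap_measurable => // i _; rewrite -[X in measurable X]setTI.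
  apply: measurable_tnth => //; exact: measurable_ball.
apply/seteqP; split => [t [_ ct] i _|t ct] /=.
  by have := ct 0 i; rewrite mxE.
by split=> // i j; rewrite ord1 mxE; exact: ct.
Qed.

Lemma rat_row_dense (R : realType) d (x : 'rV[R]_d) (e : R) : 0 < e ->
  exists q : 'rV[rat]_d, ball (map_mx ratr q : 'rV[R]_d) e x.
Proof.
move=> e0; have q_ i : exists q : rat, ball (ratr q : R) e (x 0 i).
  have [q] := @rat_in_itvoo R (x 0 i - e) (x 0 i + e) ltac:(by lra).
  rewrite in_itv/= => /andP[xq qx]; exists q.
  by rewrite /ball/= ltr_distlC; apply/andP; split; lra.
have [q qx] := choice q_; exists (\row_i q i); split=> // i j.
by rewrite ord1 !mxE.
Qed.

(** Tuples carry the product sigma-algebra and row vectors the topology of the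
    sup norm. An open set is a union of balls, that is cubes, with rational
    centre and radius 1 / (k + 1), and there are countably many of these. *)
Lemma measurable_open_row_of_tuple (R : realType) d (O : set 'rV[R]_d) :
  open O -> measurable (@row_of_tuple R d @^-1` O).
Proof.
move=> oO.
(* Index all such balls, with the empty set for those that leave O. *)
pose B (p : 'rV[rat]_d * nat) : set 'rV[R]_d :=
  if `[< ball (map_mx ratr p.1 : 'rV[R]_d) p.2.+1%:R^-1 `<=` O >]
  then ball (map_mx ratr p.1 : 'rV[R]_d) p.2.+1%:R^-1 else set0.
have -> : O = \bigcup_p B p.
  apply/seteqP; split => [x Ox|x [p _]]; last first.
    by rewrite /B; case: asboolP => // + Bx; exact.
  have /nbhs_ballP[e /= e0 eO] : nbhs x O by exact: open_nbhs_nbhs.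
  have [k ke] : exists k : nat, k.+1%:R^-1 < e / 2.
    have [k _ kP] := near_infty_natSinv_lt (PosNum (divr_gt0 e0 (ltr0Sn R 1))).
    by exists k; have := kP k (leqnn k).
  have k0 : 0 < k.+1%:R^-1 :> R by rewrite invr_gt0.
  have [q qx] := rat_row_dense x k0.
  exists (q, k) => //; rewrite /B asboolT//= => y qy; apply: eO.
  apply: (@le_ball _ _ _ (k.+1%:R^-1 + k.+1%:R^-1)).
    by rewrite [leRHS]splitr lerD// ltW.
  by apply: ball_triangle qy; exact: ball_sym.
rewrite preimage_bigcup; apply: countable_bigcupT_measurable => [|p].
  exact: countableP.
rewrite /B; case: asboolP => _; last by rewrite preimage_set0.
exact: measurable_ball_row_of_tuple.
Qed.

Lemma continuous_measurable_row_of_tuple (R : realType) d (f : 'rV[R]_d -> R) :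
  continuous f -> measurable_fun setT (f \o @row_of_tuple R d).
Proof.
move=> /continuousP cf; apply: (measurability _ (RGenOpens.measurableE R)).
move=> _ [_ [a [b ->] <-]]; rewrite setTI comp_preimage.
apply: measurable_open_row_of_tuple; apply: cf; exact: interval_open.
Qed.

(** * Integration of tuples along one coordinate *)

Definition tuple_box (T : Type) n (D : set T) : set (n.-tuple T) :=
  [set t | forall i, D (tnth t i)].
Arguments tuple_box {T} n D.

Definition tuple_set (T : Type) n (t : n.-tuple T) (i : 'I_n) (s : T) :
    n.-tuple T :=
  [tuple if j == i then s else tnth t j | j < n].

Section TupleIntegral.
Local Open Scope ereal_scope.
Context {d : measure_display} {T : measurableType d} {R : realType}.
Variable mu : {sigma_finite_measure set T -> \bar R}.

Lemma measurable_tuple_box n (D : set T) :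
  measurable D -> measurable (tuple_box n D).
Proof.
move=> mD; have -> : tuple_box n D = \bigcap_i ((@tnth n T)^~ i @^-1` D).
  by apply/seteqP; split => t Dt i; [move=> _|]; exact: Dt.
apply: fin_bigcap_measurable => // i _; rewrite -[X in measurable X]setTI.
exact: measurable_tnth.
Qed.

Lemma tuple_box_measure1 n (D : set T) :
  measurable D -> mu D = 1 -> tuple_measure mu n (tuple_box n D) = 1.
Proof.
by move=> mD D1; rewrite (@tuple_measure_box _ _ _ mu n (fun=> D))// big1.
Qed.

Lemma tuple_boxS n (D : set T) :
  @tcons _ T n @^-1` tuple_box n.+1 D = D `*` tuple_box n D.
Proof.
apply/seteqP; split => -[x t] /=.
  by move=> H; split=> [|i]; [exact: (H ord0)|have := H (lift ord0 i);
    rewrite tnthS].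
case=> /= Dx Dt i; case: (unliftP ord0 i) => [j|] ->//.
by rewrite tnthS; exact: Dt.
Qed.

Lemma tuple_set_tcons0 n s s' (t : n.-tuple T) :
  tuple_set (tcons (s', t)) ord0 s = tcons (s, t).
Proof.
apply: eq_from_tnth => i; rewrite tnth_mktuple.
by case: (unliftP ord0 i) => [j|] ->; rewrite ?eqxx//= !tnthS.
Qed.

Lemma tuple_set_tconsS n s s' (t : n.-tuple T) (j : 'I_n) :
  tuple_set (tcons (s', t)) (lift ord0 j) s = tcons (s', tuple_set t j s).
Proof.
apply: eq_from_tnth => i; rewrite tnth_mktuple.
case: (unliftP ord0 i) => [k|] ->//.
by rewrite (inj_eq lift_inj) !tnthS tnth_mktuple.
Qed.

(** Any coordinate may be integrated out first, although the product measure
    is built by peeling off the head: induction on n, with Tonelli's theorem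
    in one order when i is the head and in the other when i lies in the tail.
    When every partial integral is c there remains the integral of c over
    a set of measure 1. *)
Lemma integral_tuple_coord (D : set T) n (i : 'I_n) (f : n.-tuple T -> \bar R)
    (c : \bar R) :
  measurable D -> mu D = 1 ->
  measurable_fun [set: n.-tuple T] f -> (forall t, 0 <= f t) ->
  (forall t, tuple_box n D t -> \int[mu]_(s in D) f (tuple_set t i s) = c) ->
  \int[tuple_measure mu n]_(t in tuple_box n D) f t = c.
Proof.
move=> mD D1; elim: n i f => [[]//|n IHn] i f mf f0 fc.
(* Tonelli's theorem is used on the whole product, with f cut off outside
   the box. *)
pose fD := (f \o @tcons _ T n) \_ (D `*` tuple_box n D).
have mbox := @measurable_tuple_box n D mD.
have mDbox : measurable (D `*` tuple_box n D) by exact: measurableX.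
have mfT : measurable_fun setT (f \o @tcons _ T n).
  by apply: measurableT_comp => //; exact: measurable_tcons.
have mfD : measurable_fun setT fD.
  by apply/(measurable_restrictT _ mDbox); exact: measurable_funTS.
have fD0 p : 0 <= fD p by rewrite /fD patchE; case: ifPn => // _; exact: f0.
have fDE s t : fD (s, t) =
    if (s \in D) && (t \in tuple_box n D) then f (tcons (s, t)) else 0.
  by rewrite /fD patchE in_setX.
have -> : \int[tuple_measure mu n.+1]_(t in tuple_box n.+1 D) f t =
    \int[mu \x tuple_measure mu n]_p fD p.
  rewrite /= ge0_integral_pushforward//.
  - by rewrite tuple_boxS [LHS]integral_mkcond.
  - exact: measurable_tcons.
  - exact: measurable_tuple_box.
  - exact: measurable_funTS.
case: (unliftP ord0 i) => [j|] ij.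
- rewrite fubini_tonelli1// /fubini_F.
  rewrite (_ : (fun s => _) = cst c \_ D).
    by rewrite -integral_mkcond integral_cst// -[RHS]mule1; congr (_ * _).
  apply/funext => s; rewrite patchE; under eq_integral do rewrite fDE.
  case: ifPn => /= [/set_mem Ds|_]; last by rewrite integral0.
  rewrite -[LHS](integral_mkcond (tuple_box n D) (fun t => f (tcons (s, t)))).
  apply: (IHn j) => //.
    apply: (measurableT_comp mf).
    by apply: measurable_cons; [exact: measurable_cst|exact: measurable_id].
  move=> t Dt; rewrite -(fc (tcons (s, t))).
    by rewrite ij; apply: eq_integral => x _; rewrite tuple_set_tconsS.
  have : (D `*` tuple_box n D) (s, t) by [].
  by rewrite -tuple_boxS.
- rewrite fubini_tonelli2// /fubini_G.
  rewrite (_ : (fun t => _) = cst c \_ (tuple_box n D)).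
    by rewrite -integral_mkcond integral_cst// -[RHS]mule1;
      congr (_ * _); exact: tuple_box_measure1.
  apply/funext => t; rewrite patchE; under eq_integral do rewrite fDE andbC.
  case: ifPn => /= [/set_mem Dt|_]; last by rewrite integral0.
  rewrite -[LHS](integral_mkcond D (fun s => f (tcons (s, t)))).
  (* fc needs a point of the whole box, so some head s in D. *)
  have [s Ds] : D !=set0.
    by apply/set0P; apply: contra_eq_neq D1 => ->; rewrite measure0 lt_eqF.
  rewrite -(fc (tcons (s, t))).
    by rewrite ij; apply: eq_integral => x _; rewrite tuple_set_tcons0.
  have : (D `*` tuple_box n D) (s, t) by [].
  by rewrite -tuple_boxS.
Qed.

End TupleIntegral.

(** Adding the bound K makes a bounded f nonnegative, so that results of Tonelli
    type apply; the integral of f is then recovered by subtracting K. *)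
Lemma integral_add_bound (d : measure_display) (T : measurableType d)
    (R : realType) (mu : {measure set T -> \bar R}) (A : set T) (f : T -> R)
    (K : R) :
  measurable A -> mu A = 1%E -> measurable_fun A f ->
  (forall x, `|f x| <= K) ->
  (\int[mu]_(x in A) (f x + K)%:E = \int[mu]_(x in A) (f x)%:E + K%:E)%E.
Proof.
move=> mA A1 mf fK.
have bI (h : T -> R) (M : R) : measurable_fun A h -> (forall x, `|h x| <= M) ->
    mu.-integrable A (EFin \o h).
  move=> mh hM; apply: measurable_bounded_integrable => //.
    by rewrite A1 ltry.
  exists M; split; first exact: num_real.
  by move=> N /ltW MN x _; exact: le_trans (hM x) MN.
under eq_integral do rewrite EFinD.
rewrite integralD//=; last 2 first.
- exact: (bI f K).
- exact: (bI (cst K) `|K|).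
by rewrite integral_cst// A1 mule1.
Qed.

Lemma continuous_line (R : realType) d (x v : 'rV[R]_d) :
  continuous (fun s : R => x + s *: v).
Proof.
by move=> s; apply: cvgD; [exact: cvg_cst|apply: cvgZr_tmp; exact: cvg_id].
Qed.

(** A coordinatewise form of Fubini's theorem for the average: if g has integral
    c over every unit segment in the direction e_i, its average is c. *)
Lemma average_line (R : realType) d (g : 'rV[R]_d -> R) (i : 'I_d) (c K : R) :
  continuous g -> (forall x, `|g x| <= K) ->
  (forall x, (\int[@lebesgue_measure R]_(s in `[0%R, 1%R[)
     (g (x + s *: delta_mx 0 i)%R)%:E)%E = c%:E) ->
  average g = c.
Proof.
move=> cg gK gc.
pose mu : {sigma_finite_measure set (measurableTypeR R) -> \bar R} :=
  @lebesgue_measure R.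
pose D : set (measurableTypeR R) := `[0%R, 1%R[%classic.
have mD : measurable D by exact: measurable_itv.
have D1 : mu D = 1%E.
  by rewrite /mu/= lebesgue_measure_itv /= lte_fin ltr01 -EFinB subr0.
have YdE : @row_of_tuple R d @^-1` @Yd R d = tuple_box d D.
  by apply/seteqP; split => t /= H i0; have := H i0; rewrite mxE /D /= in_itv.
have mg := continuous_measurable_row_of_tuple cg.
(* Moving the i-th coordinate along [0, 1) runs over the unit segment that
   starts where this coordinate vanishes. *)
have rowE t s : row_of_tuple (tuple_set t i s) =
    row_of_tuple t - tnth t i *: delta_mx 0 i + s *: delta_mx 0 i.
  apply/rowP => j; rewrite !mxE tnth_mktuple eqxx/=.
  by case: eqVneq => [->|_]; rewrite ?mulr1 ?subrr ?add0r// !mulr0 subr0 addr0.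
have gline t : (\int[mu]_(s in D)
    (g (row_of_tuple (tuple_set t i s)) + K)%:E = (c + K)%:E)%E.
  under eq_integral do rewrite rowE.
  set x := row_of_tuple t - _.
  rewrite (@integral_add_bound _ _ _ mu D
    (fun s => g (x + s *: delta_mx 0 i)) K)//.
    by rewrite EFinD; congr (_ + _)%E; exact: gc.
  apply: measurable_funTS; apply: continuous_measurable_fun => s.
  by apply: continuous_comp; [exact: continuous_line|exact: cg].
have gK0 x : 0 <= g x + K.
  by have := gK x; rewrite ler_norml => /andP[? _]; rewrite -lerBlDr sub0r.
have : (\int[tuple_measure mu d]_(t in tuple_box d D)
    (g (row_of_tuple t) + K)%:E = (c + K)%:E)%E.
  apply: (integral_tuple_coord (i := i)) => //.
  - by apply/measurable_EFinP; apply: measurable_funD.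
  - by move=> t; rewrite lee_fin.
rewrite (@integral_add_bound _ _ _ (tuple_measure mu d) _
  (g \o @row_of_tuple R d) K)//; last 4 first.
- exact: measurable_tuple_box.
- exact: tuple_box_measure1.
- exact: measurable_funTS.
- by move=> t; exact: gK.
rewrite EFinD => gint.
rewrite /average YdE /Rintegral -[c]/(fine c%:E); congr fine.
by rewrite -[LHS](@addeK _ K%:E)// [X in (X - _)%E]gint addeK.
Qed.

(** * Calculus of maps between row vectors *)

Lemma determinant_continuous (R : realType) n :
  continuous (fun M : 'M[R]_n => \det M).
Proof.
rewrite /determinant; apply: continuous_big => [|s _ M].
  exact: (@add_continuous R^o).
pose P (N : 'M[R]_n) := \prod_i N i (s i).
apply: (@continuous_comp _ _ _ P ( *%R _)); last exact: mulrl_continuous.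
move: M; apply: (continuous_big mul_continuous) => i _ N.
exact: coord_continuous.
Qed.

Lemma mulmxr_differentiable (R : realType) m n p (A : 'M[R]_(n, p))
    (M : 'M[R]_(m, n)) :
  differentiable (fun N : 'M[R]_(m, n) => N *m A) M.
Proof.
rewrite (_ : (fun _ => _) = \sum_i \sum_j
    fun N : 'M[R]_(m, n) => N i j *: (delta_mx i j *m A)).
  do 2 apply: differentiable_sum => ?.
  exact/differentiableZl/differentiable_coord.
apply/funext => N; rewrite {1}(matrix_sum_delta N) mulmx_suml fct_sumE.
apply: eq_bigr => i _; rewrite mulmx_suml fct_sumE.
by apply: eq_bigr => j _; rewrite -scalemxAl.
Qed.

Lemma mulmxr_continuous (R : realType) m n p (A : 'M[R]_(n, p)) :
  continuous (fun N : 'M[R]_(m, n) => N *m A).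
Proof. by move=> M; exact/differentiable_continuous/mulmxr_differentiable. Qed.

Section LinearImage.
Context {R : realType} {d m p : nat}.
Variables (V : 'rV[R]_d -> 'rV[R]_m) (A : 'M[R]_(m, p)).

Lemma differentiable_mulmxr x :
  differentiable V x -> differentiable (fun y => V y *m A) x.
Proof.
by move=> dV; exact: (differentiable_comp dV (mulmxr_differentiable A _)).
Qed.

Lemma jacobian_mulmxr x :
  differentiable V x -> 'J (fun y => V y *m A) x = 'J V x *m A.
Proof.
move=> dV; have := mulmxr_differentiable A (V x) => dA.
rewrite /jacobian (_ : (fun y => V y *m A) = mulmxr A \o V)//.
apply/row_matrixP => i; rewrite row_mul !rowE !mul_rV_lin1.
by rewrite diff_comp//= diff_lin//; exact: mulmxr_continuous.
Qed.

End LinearImage.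

Lemma class_C1_mulmxr (R : realType) d m p (V : 'rV[R]_d -> 'rV[R]_m)
    (A : 'M[R]_(m, p)) :
  class_C1 V /\ C0_sharp (fun x => 'J V x) ->
  class_C1 (fun x => V x *m A) /\ C0_sharp (fun x => 'J (fun y => V y *m A) x).
Proof.
move=> [[dV cJ] [_ pJ]].
have JE : (fun x => 'J (fun y => V y *m A) x) = fun x => 'J V x *m A.
  by apply/funext => x; exact: jacobian_mulmxr.
have cJA : continuous (fun x => 'J V x *m A).
  move=> x.
  apply: (@continuous_comp _ _ _ (fun x => 'J V x) (fun M => M *m A)).
    exact: cJ.
  exact: mulmxr_continuous.
have pJA : Yd_periodic (fun x => 'J V x *m A) by move=> x k; rewrite pJ.
split; last by rewrite JE.
split; first by move=> x; exact/differentiable_mulmxr/dV.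
by rewrite JE.
Qed.

Lemma is_derive_line (R : realType) d (f : 'rV[R]_d -> R) (x v : 'rV[R]_d)
    (s : R) :
  derivable f (x + s *: v) v ->
  is_derive s 1 (fun t => f (x + t *: v)) ('D_v f (x + s *: v)).
Proof.
(* The difference quotients of the two derivatives coincide. *)
have E :
    (fun h : R => h^-1 *: (((fun t => f (x + t *: v)) \o shift s)
      (h *: (1 : R^o)) - f (x + s *: v))) =
    (fun h : R => h^-1 *: ((f \o shift (x + s *: v)) (h *: v) -
      f (x + s *: v))).
  apply/funext => h /=; congr (_ *: (f _ - _)).
  by rewrite [h *: _]mulr1 scalerDl addrCA.
by move=> df; split; [rewrite /derivable E|rewrite /derive E].
Qed.

Lemma derive_coord (R : realType) d m (V : 'rV[R]_d -> 'rV[R]_m)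
    (x v : 'rV[R]_d) (j : 'I_m) :
  differentiable V x ->
  is_derive x v (fun y => V y 0 j) ((v *m 'J V x) 0 j).
Proof.
move=> dV; have dVv : derivable V x v by exact: diff_derivable.
split; first exact: (derivable_mxP _ _ _).1.
by rewrite -deriveEjacobian// derive_mx// mxE.
Qed.

Lemma is_derive_coord_line (R : realType) d m (V : 'rV[R]_d -> 'rV[R]_m)
    (x v : 'rV[R]_d) (s : R) (j : 'I_m) :
  differentiable V (x + s *: v) ->
  is_derive s 1 (fun t => V (x + t *: v) 0 j)
    ((v *m 'J V (x + s *: v)) 0 j).
Proof.
move=> dV; have [dj <-] := derive_coord v j dV.
exact: (is_derive_line (f := fun y => V y 0 j)).
Qed.

(** * Periodic functions and maps with periodic Jacobian *)

Lemma Yd_translate (R : realType) d (x : 'rV[R]_d) :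
  exists k : 'rV[int]_d, Yd (x + map_mx intr k).
Proof.
exists (\row_i - Num.floor (x 0 i)) => i; rewrite !mxE rmorphN/=.
have /andP[xge xlt] := floor_itv (x 0 i).
by rewrite subr_ge0 xge ltrBlDl -intrD1.
Qed.

(** The hypotheses of the theorem are local to the unit cell; periodicity
    spreads them to the whole space. *)
Lemma Yd_periodic_ind (R : realType) d (T : Type) (f : 'rV[R]_d -> T)
    (P : T -> Prop) :
  Yd_periodic f -> (forall x, Yd x -> P (f x)) -> forall x, P (f x).
Proof.
by move=> pf Pf x; have [k /Pf] := Yd_translate x; rewrite pf.
Qed.

(** The values of f are those on the unit cell, which lies in the compact
    cube [0, 1]^d. *)
Lemma C0_sharp_max (R : realType) d (f : 'rV[R]_d -> R) :
  C0_sharp f -> exists x0, forall x, f x <= f x0.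
Proof.
move=> [cf pf].
pose Q := [set v : 'rV[R]_d | forall i, `[(0 : R), 1]%classic (v ord0 i)].
have cQ : compact Q.
  exact: (@rV_compact _ _ (fun=> `[(0 : R), 1]%classic)
    (fun=> @segment_compact R 0 1)).
have Q0 : Q !=set0 by exists 0 => i; rewrite /= in_itv/= !mxE lexx ler01.
have [x0 _ x0max] := EVT_max_rV Q0 cQ (continuous_subspaceT cf).
exists x0; apply: (Yd_periodic_ind (P := fun y => y <= f x0)) => // x Yx.
apply: x0max; rewrite inE => i /=; rewrite in_itv/=.
by have /andP[-> /ltW] := Yx i.
Qed.

Lemma C0_sharp_bounded (R : realType) d (f : 'rV[R]_d -> R) :
  C0_sharp f -> exists K, forall x, `|f x| <= K.
Proof.
move=> [cf pf]; have [|x0 fx0] := @C0_sharp_max R d (fun x => `|f x|).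
  split; last by move=> x k; rewrite pf.
  by move=> x; apply: continuous_comp; [exact: cf|exact: norm_continuous].
by exists `|f x0|.
Qed.

Section Increments.
Context {R : realType} {d m : nat}.
Variable V : 'rV[R]_d -> 'rV[R]_m.
Hypothesis dV : forall x, differentiable V x.
Hypothesis pJ : Yd_periodic (fun x => 'J V x).

(** The Jacobian of x |-> V (x + k) - V x vanishes, as 'J V is periodic. *)
Lemma increment_cst (x : 'rV[R]_d) (k : 'rV[int]_d) :
  V (x + map_mx intr k) - V x = V (map_mx intr k) - V 0.
Proof.
set w := map_mx intr k; apply/rowP => j; rewrite !mxE.
pose u (s : R) := V (w + s *: x) 0 j - V (0 + s *: x) 0 j.
have du (s : R) : is_derive s 1 u 0.
  have dw := is_derive_coord_line j (@dV (w + s *: x)).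
  have d0 := is_derive_coord_line j (@dV (0 + s *: x)).
  have := is_deriveB dw d0.
  have -> : 'J V (w + s *: x) = 'J V (0 + s *: x) by rewrite add0r addrC /w pJ.
  by rewrite subrr.
have := is_derive_0_is_cst 1 0 du.
by rewrite /u !scale1r !scale0r !addr0 !add0r [w + x]addrC.
Qed.

(** Each segment from x to x + e_i contributes the increment of V between its
    ends, by the fundamental theorem of calculus, and this increment does not
    depend on x. *)
Lemma average_jacobian_row (i : 'I_d) : C0_sharp (fun x => 'J V x) ->
  row i (average_mx (fun x => 'J V x)) = V (delta_mx 0 i) - V 0.
Proof.
move=> [cJ _]; apply/rowP => j; rewrite !mxE.
have cJij : continuous (fun x => 'J V x i j).
  move=> x; apply: (@continuous_comp _ _ _ (fun x => 'J V x) (fun M => M i j)).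
    exact: cJ.
  exact: coord_continuous.
have [|K JK] := @C0_sharp_bounded R d (fun x => 'J V x i j).
  split; first exact: cJij.
  by move=> x k; rewrite pJ.
apply: (average_line (i := i) cJij JK) => x.
pose F (s : R) : R := V (x + s *: delta_mx 0 i) 0 j.
pose f (s : R) : R := 'J V (x + s *: delta_mx 0 i) i j.
have dF (s : R) : is_derive s 1 F (f s).
  have := is_derive_coord_line j (@dV (x + s *: delta_mx 0 i)).
  by rewrite -rowE mxE.
have cf : continuous f.
  move=> s; apply: (@continuous_comp _ _ _
    (fun s : R => x + s *: delta_mx 0 i) (fun y => 'J V y i j)).
    exact: continuous_line.
  exact: cJij.
have cF : continuous F.
  by move=> s; apply/differentiable_continuous/derivable1_diffP; case: (dF s).
rewrite integral_itv_bndo_bndc; last first.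
  apply/measurable_EFinP/measurable_funTS; exact: continuous_measurable_fun.
rewrite (@continuous_FTC2 _ f F)//; last 3 first.
- exact: continuous_subspaceT.
- split.
  + by move=> s _; case: (dF s).
  + exact/cvg_at_right_filter/cF.
  + exact/cvg_at_left_filter/cF.
- by move=> s _; rewrite derive1E; case: (dF s).
rewrite -EFinB; congr _%:E; rewrite /F scale0r addr0 scale1r.
have := increment_cst x (delta_mx 0 i); rewrite map_delta_mx => /rowP/(_ j).
by rewrite !mxE.
Qed.

End Increments.

(** * The average of an everywhere invertible periodic Jacobian *)

Lemma int_row_ind d (P : 'rV[int]_d -> Prop) :
  P 0 -> (forall k l, P k -> P l -> P (k + l)) -> (forall k, P k -> P (- k)) ->
  (forall i, P (delta_mx 0 i)) -> forall k, P k.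
Proof.
move=> P0 PD PN Pe k; rewrite [k]row_sum_delta.
apply: (big_ind P) => // i _.
have Pn n : P (n%:Z *: delta_mx 0 i).
  elim: n => [|n IHn]; first by rewrite scale0r.
  by rewrite intS scalerDl scale1r; exact: PD.
case: (k 0 i) => n; first exact: Pn.
by rewrite NegzE scaleNr; exact/PN/Pn.
Qed.

(** If the average kills a column c <> 0, the increments of V *m c along
    the basis vectors vanish, so V *m c is periodic. At a maximum of V *m c
    its gradient 'J V *m c is 0, which contradicts invertibility there. *)
Lemma average_jacobian_unit (R : realType) d (V : 'rV[R]_d -> 'rV[R]_d) :
  class_C1 V /\ C0_sharp (fun x => 'J V x) ->
  (forall x, 'J V x \in unitmx) ->
  average_mx (fun x => 'J V x) \in unitmx.
Proof.
move=> VC Ju; have [[dV _] cpJ] := VC; have pJ := cpJ.2.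
rewrite unitmxE unitfE -det_tr; apply/negP => /det0P[u u0 uM].
pose c := u^T.
have Mc : average_mx (fun x => 'J V x) *m c = 0.
  by rewrite -[LHS]trmxK trmx_mul trmxK uM trmx0.
have per (k : 'rV[int]_d) : (V (map_mx intr k) - V 0) *m c = 0.
  elim/int_row_ind: k => [|k l Hk Hl|k Hk|i].
  - by rewrite map_mx0 subrr mul0mx.
  - by rewrite map_mxD -(subrK (V (map_mx intr k)) (V (_ + _))) -addrA mulmxDl
      increment_cst// Hk addr0 Hl.
  - (* Compare the increment at 0 with the one at - k. *)
    have := increment_cst dV pJ (map_mx intr k) (- k).
    by rewrite map_mxN subrr => <-; rewrite -opprB mulNmx Hk oppr0.
  - by rewrite map_delta_mx -average_jacobian_row// -row_mul Mc row0.
pose f x := (V x *m c) 0 0.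
have df x : differentiable (fun y => V y *m c) x.
  exact: differentiable_mulmxr.
have cf : continuous f.
  move=> x.
  apply: (@continuous_comp _ _ _ (fun y => V y *m c) (fun M => M 0 0)).
    exact: differentiable_continuous.
  exact: coord_continuous.
have pf : Yd_periodic f.
  move=> x k; apply/eqP; rewrite -subr_eq0 /f.
  have /matrixP/(_ 0 0) := per k.
  by rewrite -(increment_cst dV pJ x) mulmxBl !mxE => /eqP.
have [x0 fx0] := C0_sharp_max (conj cf pf).
have Jc : 'J V x0 *m c = 0.
  apply/matrixP => i j; rewrite ord1 [RHS]mxE {j}.
  have dg s := is_derive_coord_line (V := fun y => V y *m c) 0
    (df (x0 + s *: delta_mx 0 i)).
  have d0 : is_derive (0 : R) 1 (fun t => f (x0 + t *: delta_mx 0 i)) 0.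
    apply: (@derive1_at_max _ _ (-1) 1) => [|t _||t _].
    - by lra.
    - by case: (dg t).
    - by rewrite in_itv/=; apply/andP; split; lra.
    - by rewrite scale0r addr0.
  case: (dg 0) => _; case: d0 => _ ->.
  by rewrite scale0r addr0 jacobian_mulmxr// -rowE mxE => <-.
move: u0; rewrite -[u]trmxK -/c -(mulKmx (Ju x0) c) Jc mulmx0 trmx0.
by rewrite eqxx.
Qed.

(** * Cross products and straightening *)

(** In the plane the cross product of a single vector is its clockwise rotation,
    so the case d = 2 is the general one. *)
Lemma perp_product_cross (R : realType) n (g : 'I_n.+2 -> 'rV[R]_n.+2) :
  perp_product g = cross_product (fun j => g (lift ord0 j)).
Proof.
case: n g => [|n] g //=; apply/rowP => i.
rewrite [RHS]mxE (expand_det_row _ ord0) !big_ord_recl big_ord0 addr0.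
have ll0 : lift (lift ord0 ord0) 0 = ord0 :> 'I_2 by exact: val_inj.
have l0 : lift ord0 0 = lift ord0 ord0 :> 'I_2 by exact: val_inj.
have l1 : 1 = lift ord0 ord0 :> 'I_2 by exact: val_inj.
have [i0 i1] : ord0 = lshift 1 (ord0 : 'I_1) :> 'I_2 /\
    lift ord0 ord0 = rshift 1 (ord0 : 'I_1) :> 'I_2 by split; exact: val_inj.
have R00 : @R_perp R ord0 ord0 = 0.
  by rewrite i0; apply: etrans (block_mxEul _ _ _ _ _ _) _; rewrite mxE.
have R01 : @R_perp R ord0 (lift ord0 ord0) = 1.
  by rewrite i1 i0; apply: etrans (block_mxEur _ _ _ _ _ _) _; rewrite mxE.
have R10 : @R_perp R (lift ord0 ord0) ord0 = -1.
  by rewrite i1 i0; apply: etrans (block_mxEdl _ _ _ _ _ _) _; rewrite mxE.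
have R11 : @R_perp R (lift ord0 ord0) (lift ord0 ord0) = 0.
  by rewrite i1; apply: etrans (block_mxEdr _ _ _ _ _ _) _; rewrite mxE.
rewrite /cofactor !det_mx11 !mxE ll0 unlift_none !liftK.
rewrite big_ord_recl big_ord1 /=.
rewrite ![(g 1)^T _ _]mxE l1.
case: (unliftP ord0 i) => [k|] ->; rewrite ?[k]ord1 ?R00 ?R01 ?R10 ?R11.
  by rewrite !mxE /= l0 ?expr1; ring.
by rewrite !mxE /= l0 ?expr1; ring.
Qed.

(** The k-th entry on the left is the determinant of J with its first column
    replaced by the k-th one: det J if k = 0, and 0 otherwise since a column
    is repeated. *)
Lemma cross_product_mulmx (R : realType) n (J : 'M[R]_n.+1) :
  cross_product (fun j => row (lift ord0 j) J^T) *m J =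
  \det J *: delta_mx 0 0.
Proof.
apply/rowP => k; rewrite [RHS]mxE [delta_mx _ _ _ _]mxE eqxx /=.
pose M := cols_mx (row k J^T) (fun j => row (lift ord0 j) J^T).
have -> : (cross_product (fun j => row (lift ord0 j) J^T) *m J) 0 k = \det M.
  rewrite -dot_cross_product mxE; apply: eq_bigr => i _.
  by rewrite !mxE mulrC.
case: (unliftP ord0 k) => [j|] kE.
  rewrite kE eq_sym (negPf (neq_lift _ _)) mulr0 -det_tr.
  apply: (@determinant_alternate _ _ _ ord0 k); first by rewrite kE neq_lift.
  by move=> i; rewrite !mxE unlift_none kE liftK !mxE.
rewrite kE eqxx mulr1; congr (\det _).
apply/matrixP => i j; rewrite !mxE.
by case: (unliftP ord0 j) => [l|] ->; rewrite !mxE// kE.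
Qed.

Lemma gradient_row (R : realType) d m (V : 'rV[R]_d -> 'rV[R]_m) x j :
  differentiable V x -> gradient (comp_field V j) x = row j ('J V x)^T.
Proof.
by move=> dV; apply/rowP => i; rewrite -jacobianE// [RHS]mxE [RHS]mxE.
Qed.

Lemma perp_product_gradient (R : realType) n
    (V : 'rV[R]_n.+2 -> 'rV[R]_n.+2) x :
  differentiable V x ->
  perp_product (fun j => gradient (comp_field V j) x) *m 'J V x =
  \det ('J V x) *: delta_mx 0 0.
Proof.
move=> dV; rewrite perp_product_cross -cross_product_mulmx.
congr (cross_product _ *m _); apply/funext => j; exact: gradient_row.
Qed.

Lemma continuous_neq0_gt0 (R : realType) d (f : 'rV[R]_d -> R) x y :
  continuous f -> (forall z, f z != 0) -> 0 < f x -> 0 < f y.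
Proof.
move=> cf f0 fx; rewrite ltNge le_eqVlt (negPf (f0 y)) /=; apply/negP => fy.
pose g (s : R) : R := f (x + s *: (y - x)).
have cg : continuous g.
  by move=> s; apply: continuous_comp; [exact: continuous_line|exact: cf].
have g0 : g 0 = f x by rewrite /g scale0r addr0.
have g1 : g 1 = f y by rewrite /g scale1r addrC subrK.
have [|s _ gs] := @IVT R g 0 1 0 ler01 (continuous_subspaceT cg).
  by rewrite g0 g1 ge_min le_max (ltW fx) (ltW fy) orbT.
by have := f0 (x + s *: (y - x)); rewrite -/(g s) gs eqxx.
Qed.

(** Any matrix that sends xi to e_0 may be followed by a diagonal matrix that
    fixes e_0; a second coordinate, available as the dimension is at least 2,
    is rescaled so that s * \det A becomes a square. *)
Lemma straightening_matrix (R : realType) n (xi : 'rV[R]_n.+2) (s : R) :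
  xi != 0 -> s != 0 ->
  exists A : 'M[R]_n.+2,
    [/\ A \in unitmx, xi *m A = delta_mx 0 0 & 0 < s * \det A].
Proof.
move=> /rV0Pn[i xi0] s0.
pose f : 'M[R]_n.+2 := (xi 0 i)^-1 *: delta_mx i 0.
have xif : xi *m f = delta_mx 0 0.
  apply/rowP => j; rewrite !mxE (bigD1 i)//= big1.
    by rewrite !mxE eqxx addr0 /= mulrA mulfV// mul1r.
  by move=> k ki; rewrite !mxE (negPf ki) !mulr0.
have [|g gu xig] := @complete_unitmx _ _ _ xi f.
  rewrite xif mxrank_delta; apply/esym/eqP; rewrite eqn_leq rank_leq_row lt0n.
  by rewrite mxrank_eq0; apply/rV0Pn; exists i.
have dg0 : \det g != 0 by rewrite -unitfE -unitmxE.
pose t : 'rV[R]_n.+2 :=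
  \row_j if j == 0 then 1 else if j == 1 then s * \det g else 1.
have dt : \det (diag_mx t) = s * \det g.
  rewrite det_diag (bigD1 1)//= !mxE/= big1 ?mulr1// => j /negPf j1.
  by rewrite mxE j1 if_same.
exists (g *m diag_mx t); split.
- by rewrite unitmx_mul gu unitmxE unitfE dt mulf_neq0.
- rewrite mulmxA -xig xif -rowE; apply/rowP => j; rewrite !mxE.
  by rewrite eqxx eq_sym; case: (j == 0); rewrite ?mulr0n.
- by rewrite det_mulmx dt mulrA -expr2 exprn_even_gt0//= mulf_neq0.
Qed.

(** * The equivalence *)

Lemma average_jacobian_mulmxr (R : realType) d m p (V : 'rV[R]_d -> 'rV[R]_m)
    (A : 'M[R]_(m, p)) :
  class_C1 V /\ C0_sharp (fun x => 'J V x) ->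
  average_mx (fun x => 'J (fun y => V y *m A) x) =
  average_mx (fun x => 'J V x) *m A.
Proof.
move=> VC; have [[dW _] cpJW] := class_C1_mulmxr A VC.
have [[dV _] cpJV] := VC.
apply/row_matrixP => i; rewrite row_mul.
rewrite (average_jacobian_row dW cpJW.2 i cpJW).
by rewrite (average_jacobian_row dV cpJV.2 i cpJV) mulmxBl.
Qed.

Theorem theorem3p3 (R : realType) (n : nat) (b : 'rV[R]_n.+2 -> 'rV[R]_n.+2)
    (hb : C0_sharp b) :
  (exists (sigma : 'rV[R]_n.+2 -> R) (V : 'rV[R]_n.+2 -> 'rV[R]_n.+2),
    [/\ C0_sharp sigma /\ (forall x, 0 < sigma x),
        class_C1 V /\ C0_sharp (fun x => 'J V x),
        (forall x, Yd x -> dot (b x) (gradient (comp_field V 0) x) = 1) &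
        (forall x, Yd x ->
          sigma x *: b x = perp_product (fun j => gradient (comp_field V j) x))])
  <->
  (exists (W : 'rV[R]_n.+2 -> 'rV[R]_n.+2) (xi : 'rV[R]_n.+2),
    [/\ xi != 0,
        class_C1 W /\ C0_sharp (fun x => 'J W x),
        average_mx (fun x => 'J W x) = 1%:M,
        (forall x, Yd x -> \det ('J W x) != 0) &
        (forall x, Yd x -> ('J W x)^T *m (b x)^T = xi^T)]).
Proof.
have dotE (V : 'rV[R]_n.+2 -> 'rV[R]_n.+2) x : differentiable V x ->
    dot (b x) (gradient (comp_field V 0) x) = (b x *m 'J V x) 0 0.
  move=> dV; rewrite gradient_row// mxE; apply: eq_bigr => i _.
  by congr (_ * _); rewrite !mxE.
split=> [[sigma [V [[_ sigma0] VC bV1 bV]]]|[W [xi [xi0 WC _ JW0 bW]]]].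
- have [[dV _] [_ pJ]] := VC.
  (* sigma *: b is the product of gradients, so the first entry of its image
     under 'J V gives sigma = \det ('J V), and sigma then cancels. *)
  have bJ x : Yd x -> \det ('J V x) = sigma x /\ b x *m 'J V x = delta_mx 0 0.
    move=> Yx; have := perp_product_gradient (dV x).
    rewrite -bV// -scalemxAl => sbJ.
    have detE : \det ('J V x) = sigma x.
      have /rowP/(_ 0) := sbJ.
      by rewrite mxE -dotE// bV1// mulr1 !mxE eqxx mulr1.
    by split=> //; apply: (scalerI (lt0r_neq0 (sigma0 x))); rewrite sbJ detE.
  have Ju x : 'J V x \in unitmx.
    apply: (Yd_periodic_ind (P := fun M => M \in unitmx) pJ) => {}x Yx.
    by rewrite unitmxE unitfE (bJ x Yx).1 gt_eqF.
  have Mu := average_jacobian_unit VC Ju.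
  set A := invmx (average_mx (fun x => 'J V x)).
  have Au : A \in unitmx by rewrite unitmx_inv.
  exists (fun x => V x *m A), (delta_mx 0 0 *m A); split.
  + apply/eqP => /(congr1 (mulmx^~ (invmx A))); rewrite mulmxK// mul0mx.
    move=> /matrixP/(_ 0 0); rewrite !mxE !eqxx => /eqP.
    by rewrite oner_eq0.
  + exact: class_C1_mulmxr.
  + by rewrite average_jacobian_mulmxr// mulmxV.
  + move=> x Yx; rewrite jacobian_mulmxr// -unitfE -unitmxE unitmx_mul Au andbT.
    exact: Ju.
  + by move=> x Yx; rewrite -trmx_mul jacobian_mulmxr// mulmxA (bJ x Yx).2.
- have [[dW cJ] [_ pJ]] := WC.
  have det0 x : \det ('J W x) != 0.
    exact: (Yd_periodic_ind (P := fun M => \det M != 0) pJ).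
  have [A [Au xiA dA]] := straightening_matrix xi0 (det0 0).
  pose V x := W x *m A.
  have VC : class_C1 V /\ C0_sharp (fun x => 'J V x) by exact: class_C1_mulmxr.
  have [[dV cJV] [_ pJV]] := VC.
  have JVE x : 'J V x = 'J W x *m A by exact: jacobian_mulmxr.
  have cdet : continuous (fun x => \det ('J V x)).
    move=> x.
    apply: (@continuous_comp _ _ _ (fun x => 'J V x) (fun M => \det M)).
      exact: cJV.
    exact: determinant_continuous.
  have bJ x : Yd x -> b x *m 'J V x = delta_mx 0 0.
    move=> Yx; rewrite JVE mulmxA -xiA; congr (_ *m _).
    by apply: trmx_inj; rewrite trmx_mul bW.
  have detV0 x : 0 < \det ('J V x).
    apply: (continuous_neq0_gt0 (f := fun x => \det ('J V x)) (x := 0)).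
    - exact: cdet.
    - by move=> z; rewrite JVE det_mulmx mulf_neq0// -unitfE -unitmxE.
    - by rewrite JVE det_mulmx.
  exists (fun x => \det ('J V x)), V; split.
  + by split; [split; [exact: cdet|move=> x k; rewrite pJV]|exact: detV0].
  + exact: VC.
  + by move=> x Yx; rewrite dotE// bJ// mxE !eqxx.
  + move=> x Yx; have Ju : 'J V x \in unitmx by rewrite unitmxE unitfE gt_eqF.
    apply: (can_inj (mulmxK Ju)).
    by rewrite -scalemxAl bJ// perp_product_gradient.
Qed.
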